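(* Let $H\in\mathcal{H}^+$ be a positive-Horn expression, let $h_1,\ldots,h_k$ be all the positive occurrences (occurrences of elements of $\mathcal{L}\cup\{\bot\}$ not under an overline) in $H$, and let $\Delta_i=\Delta(H,h_i)$. Then $H$ is strongly equivalent to $$H_\Delta=\textstyle\bigwedge\big[\ \bigvee(h_1\ \Delta_1)\ \ldots\ \bigvee(h_k\ \Delta_k)\ \big],$$ i.e. for every interpretation $I$ the reducts $H^I$ and $(H_\Delta)^I$ are logically equivalent.
   Context: Fix a set $\mathcal{A}$ of propositional atoms; $\mathcal{L}=\mathcal{A}\cup\{\neg a:a\in\mathcal{A}\}$ is the set of literals; for $\ell\in\mathcal{L}$, $\mathit{not}\,\ell$ is a default literal. Elementary expressions: $\mathcal{E}^1=\mathcal{L}\cup\{\mathit{not}\,\ell:\ell\in\mathcal{L}\}\cup\{\top,\bot\}$. For each $x\in\mathcal{E}^1$ there is a negative (overlined) elementary expression $\overline{x}$. Expressions are built from elementary and overlined elementary expressions with $\bigwedge[\varphi_1\ldots\varphi_k]$ and $\bigvee(\varphi_1\ldots\varphi_k)$. An interpretation is a set $I\subseteq\mathcal{L}$ containing no pair $a,\neg a$. Satisfaction: $I\models\top$, $I\not\models\bot$; $I\models\ell$ iff $\ell\in I$; $I\models\mathit{not}\,\ell$ iff $\ell\notin I$; $I\models\overline{x}$ iff $I\not\models x$; conjunction/disjunction as usual. Reduct w.r.t. $I$: $x^I=x$ for $x\in\mathcal{L}\cup\{\top,\bot\}$; $(\mathit{not}\,\ell)^I=\bot$ if $\ell\in I$,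 $\top$ otherwise; $(\overline{x})^I=\overline{x^I}$; reducts commute with $\bigwedge,\bigvee$. Two default-free expressions are logically equivalent if they are satisfied by exactly the same interpretations. Positive elements: members of $\mathcal{L}\cup\{\bot\}$. $\mathcal{N}$: expressions built by $\bigwedge,\bigvee$ in which every elementary occurrence is overlined. $\mathcal{H}^+$ (positive-Horn expressions) is the smallest set with: (1) $\mathcal{L}\cup\{\bot\}\subseteq\mathcal{H}^+$; (2) $\varphi_1,\ldots,\varphi_k\in\mathcal{H}^+\Rightarrow\bigwedge[\varphi_1\ldots\varphi_k]\in\mathcal{H}^+$; (3) if for some $i$, $\varphi_i\in\mathcal{H}^+$ and $\varphi_j\in\mathcal{N}$ for all $j\neq i$, then $\bigvee(\varphi_1\ldots\varphi_k)\in\mathcal{H}^+$. For $H\in\mathcal{H}^+$ and a fixed positive occurrence $h$, $\Delta(H,h)$ is defined recursively: if $H$ is this occurrence, $\Delta(H,h)=\bot$; if $H=\bigwedge[H_1\ldots H_k]$ with the occurrence in $H_i$, $\Delta(H,h)=\Delta(H_i,h)$; if $H=\bigvee(H_1\ldots H_k)$ with the occurrence in $H_i$, $\Delta(H,h)=\bigvee(H_1\ldots H_{i-1}\ \Delta(H_i,h)\ H_{i+1}\ldots H_k)$. *)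

(* Defs.v *)
From mathcomp Require Import all_boot.
From mathcomp Require Import boolp classical_sets.

Set Implicit Arguments.
Unset Strict Implicit.
Unset Printing Implicit Defensive.

Section Syntax.
Variable A : Type.

Inductive literal : Type := PosLit of A | NegLit of A.

Inductive elementary : Type :=
| Lit of literal
| NotLit of literal (* the default literal "not l" *)
| Top
| Bot.

(* [Over x] is the overlined (negative) version of [x]; the lists under [And]
   and [Or] may be empty. *)
Inductive expr : Type :=
| Elem of elementary
| Over of elementary
| And of seq expr
| Or of seq expr.

End Syntax.

Arguments Top {A}.
Arguments Bot {A}.

Definition botE {A : Type} : expr A := Elem Bot.

Section Semantics.
Variable A : Type.
Implicit Types (I J : set (literal A)) (x : elementary A) (phi psi : expr A).

Definition interpretation I : Prop :=
  forall a, ~ (I (PosLit a) /\ I (NegLit a)).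

Definition elem_sat I x : bool :=
  match x with
  | Lit l => l \in I
  | NotLit l => l \notin I
  | Top => true
  | Bot => false
  end.

Fixpoint sat I phi : bool :=
  match phi with
  | Elem x => elem_sat I x
  | Over x => ~~ elem_sat I x
  | And s => all (sat I) s
  | Or s => has (sat I) s
  end.

Definition elem_reduct I x : elementary A :=
  if x is NotLit l then (if l \in I then Bot else Top) else x.

Fixpoint reduct I phi : expr A :=
  match phi with
  | Elem x => Elem (elem_reduct I x)
  | Over x => Over (elem_reduct I x)
  | And s => And (map (reduct I) s)
  | Or s => Or (map (reduct I) s)
  end.

(* Meant for default-free expressions; reducts always are default-free. *)
Definition logically_equivalent phi psi : Prop :=
  forall J, interpretation J -> sat J phi = sat J psi.

Definition strongly_equivalent phi psi : Prop :=
  forall I, interpretation I ->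
    logically_equivalent (reduct I phi) (reduct I psi).

End Semantics.

Section PositiveHorn.
Variable A : Type.
Implicit Types (x : elementary A) (phi H : expr A) (s : seq (expr A)).

Definition positive_element x : bool :=
  match x with
  | Lit _ | Bot => true
  | NotLit _ | Top => false
  end.

Fixpoint negative_expr phi : bool :=
  match phi with
  | Elem _ => false
  | Over _ => true
  | And s | Or s => all negative_expr s
  end.

Inductive positive_horn : expr A -> Prop :=
| PH_elem x : positive_element x -> positive_horn (Elem x)
| PH_and s :
    (forall i, i < size s -> positive_horn (nth botE s i)) ->
    positive_horn (And s)
| PH_or s i :
    i < size s -> positive_horn (nth botE s i) ->
    (forall j, j < size s -> j != i -> negative_expr (nth botE s j)) ->
    positive_horn (Or s).

(* An occurrence is identified with its position: the path of argument
   indices (counted from 0) leading to it from the root. *)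
Definition position := seq nat.

Fixpoint subexpr H (p : position) : option (expr A) :=
  match p, H with
  | [::], _ => Some H
  | i :: q, And s | i :: q, Or s => obind (subexpr^~ q) (onth s i)
  | _ :: _, _ => None
  end.

(* [Over x] is a leaf, so no position leads below an overline. *)
Definition positive_occurrence H (p : position) : bool :=
  if subexpr H p is Some (Elem x) then positive_element x else false.

(* Only meaningful when [p] is a positive occurrence in [H]. *)
Fixpoint Delta H (p : position) : expr A :=
  match p, H with
  | [::], _ => botE
  | i :: q, And s => Delta (nth botE s i) q
  | i :: q, Or s => Or (set_nth botE s i (Delta (nth botE s i) q))
  | _ :: _, _ => H
  end.

Definition HDelta H (hs : seq position) : expr A :=
  And [seq Or [:: odflt botE (subexpr H h); Delta H h] | h <- hs].

End PositiveHorn.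

(* Main.v *)
(* Fix I and J and write v for satisfaction of the I-reduct by J.  By induction
   on H, v H holds iff v h || v (Delta H h) for every positive occurrence h.
   In a disjunction, negative disjuncts contain no positive occurrence, so all
   the h lie in the one Horn disjunct, and the truth value of the others is a
   common disjunct that distributes over the conjunction indexed by h. *)
Require Import Defs.
From mathcomp Require Import all_boot.
From mathcomp Require Import boolp classical_sets.

Lemma onth_if_nth T (x0 : T) (s : seq T) i :
  onth s i = if i < size s then Some (nth x0 s i) else None.
Proof. by elim: s i => [|x s IHs] [|i] //=; rewrite ltnS -IHs. Qed.

(** Separates the rewritten disjunct of a [Delta] from the untouched ones; the bound on [i] keeps
    [set_nth] from padding the list. *)
Lemma has_set_nth T (x0 : T) (a : pred T) (s : seq T) i y : i < size s ->
  has a (set_nth x0 s i y) <->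
  a y \/ (exists2 j, j < size s & j != i /\ a (nth x0 s j)).
Proof.
move=> lt_is.
have szE : size (set_nth x0 s i y) = size s.
  by rewrite size_set_nth; apply/maxn_idPr.
split=> [/(has_nthP x0)[j]|[ay|[j lt_js [ne_ji aj]]]].
- rewrite szE nth_set_nth /= => lt_js; case: (eqVneq j i) => [_ ay|ne_ji aj].
    by left.
  by right; exists j.
- by apply/(has_nthP x0); exists i; rewrite ?szE // nth_set_nth /= eqxx.
- by apply/(has_nthP x0); exists j; rewrite ?szE // nth_set_nth /= (negPf ne_ji).
Qed.

Section Occurrences.
Variable A : Type.
Implicit Types (phi : expr A) (s : seq (expr A)) (p q : position).

Lemma subexpr_And s i q : i < size s ->
  subexpr (And s) (i :: q) = subexpr (nth botE s i) q.
Proof. by move=> lt_is; rewrite /= (onth_if_nth _ botE) lt_is. Qed.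

Lemma subexpr_Or s i q : i < size s ->
  subexpr (Or s) (i :: q) = subexpr (nth botE s i) q.
Proof. exact: subexpr_And. Qed.

Lemma positive_occurrence_And s i q :
  positive_occurrence (And s) (i :: q) =
  (i < size s) && positive_occurrence (nth botE s i) q.
Proof. by rewrite /positive_occurrence /= (onth_if_nth _ botE); case: ifP. Qed.

Lemma positive_occurrence_Or s i q :
  positive_occurrence (Or s) (i :: q) =
  (i < size s) && positive_occurrence (nth botE s i) q.
Proof. exact: positive_occurrence_And. Qed.

Lemma negative_no_positive_occurrence phi p :
  negative_expr phi -> positive_occurrence phi p = false.
Proof.
(* Induction on the position avoids a nested induction through the lists inside [expr]. *)
elim: p phi => [|i q IHq] [x|x|s|s] //= /(all_nthP botE) neg_s.
- by rewrite positive_occurrence_And; case: ltnP => //= /neg_s/IHq.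
- by rewrite positive_occurrence_Or; case: ltnP => //= /neg_s/IHq.
Qed.

(** Quantifying over positions lets the induction descend by stripping one index, with no list of
    occurrences to split. *)
Lemma positive_horn_satP (I J : set (literal A)) (H : expr A) :
  positive_horn H ->
  sat J (reduct I H) <->
  (forall p, positive_occurrence H p ->
     sat J (reduct I (odflt botE (subexpr H p))) \/
     sat J (reduct I (Delta H p))).
Proof.
elim=> {H} [x pos_x|s _ IHs|s i lt_is _ IHi neg_s].
(* A leaf has only the root position, where [Delta] is [botE], which is never satisfied. *)
- split=> [Jx [|//] _|/(_ [::] pos_x) [//|//]]; by left.
- rewrite /= all_map; split=> [/(all_nthP botE) Js [//|i q]|Js].
    rewrite positive_occurrence_And => /andP[lt_is pos_q].
    by rewrite subexpr_And //; apply: (IHs i lt_is).1 => //; apply: Js.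
  apply/(all_nthP botE) => i lt_is /=; apply/(IHs i lt_is).2 => q pos_q.
  by rewrite -subexpr_And //; apply: Js (i :: q) _;
     rewrite positive_occurrence_And lt_is.
- have delta_or q : sat J (reduct I (Delta (Or s) (i :: q))) <->
      sat J (reduct I (Delta (nth botE s i) q)) \/
      (exists2 j, j < size s & j != i /\ sat J (reduct I (nth botE s j))).
    by rewrite /= has_map; apply: has_set_nth.
  split=> [|Js].
    rewrite /= has_map => /(has_nthP botE)[j lt_js Jj] [//|k q].
    rewrite positive_occurrence_Or => /andP[lt_ks pos_q].
    have eq_ki : k = i.
      apply/eqP/negP => /negP ne_ki.
      by rewrite negative_no_positive_occurrence // in pos_q; apply: neg_s.
    subst k; rewrite subexpr_Or //.
    (* A true disjunct other than [i] survives inside every [Delta]; for [i] itself the induction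
       hypothesis decides. *)
    have [eq_ji|ne_ji] := eqVneq j i.
      subst j; have [|Jd] := IHi.1 Jj q pos_q; first by left.
      by right; apply/delta_or; left.
    by right; apply/delta_or; right; exists j.
  rewrite /= has_map; apply/(has_nthP botE).
  (* If no disjunct besides [i] holds, each [Delta] of the disjunction has the value of the [Delta]
     of disjunct [i], so the induction hypothesis yields that disjunct. *)
  have [[j lt_js [_ Jj]]|noJ] := pselect (exists2 j, j < size s &
      j != i /\ sat J (reduct I (nth botE s j))); first by exists j.
  exists i => //=; apply/IHi => q pos_q.
  have [||/delta_or[|//]] := Js (i :: q).
  + by rewrite positive_occurrence_Or lt_is.
  + by rewrite subexpr_Or //; left.
  + by right.
Qed.

End Occurrences.

Theorem theorem3 (A : Type) (H : expr A) (hs : seq position) :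
  positive_horn H ->
  uniq hs ->
  (forall p : position, (p \in hs) = positive_occurrence H p) ->
  strongly_equivalent H (HDelta H hs).
Proof.
move=> horn_H _ hsE I _ J _.
apply/idP/idP => [/(positive_horn_satP _ I J _ horn_H) JH|].
  rewrite /= !all_map; apply/allP => p; rewrite hsE => /JH[] /= ->.
    by [].
  by rewrite orbT.
rewrite /= !all_map => /allP JH; apply/(positive_horn_satP _ I J _ horn_H) => p.
(* [orbF] drops the empty tail of the two-element [Or] belonging to [p]. *)
by rewrite -hsE => /JH /=; rewrite orbF => /orP.
Qed.
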